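(* Let $n\ge 2$ be finite. There is no cocycle $d$ on the Cuntz groupoid $G_n$ which is bounded and which vanishes precisely on $D_0$ (i.e. $d^{-1}(0)=D_0$). There is no cocycle $d$ on $G_n$ which is integer valued and which vanishes precisely on $D_0$.
   Context: $X=\prod_{1}^{\infty}\{1,\dots,n\}$ with the product topology. For a (possibly empty) finite string $\alpha$ in $\{1,\dots,n\}$, $\ell(\alpha)$ is its length, and $\alpha\gamma$ ($\gamma\in X$) is the concatenation. The Cuntz groupoid is $G_n=\{(\alpha\gamma,\ell(\alpha)-\ell(\beta),\beta\gamma)\mid \alpha,\beta \text{ finite strings},\ \gamma\in X\}$ with $(x,k,y)(y,j,z)=(x,k+j,z)$, $(x,k,y)^{-1}=(y,-k,x)$, and topology with basis the sets $U_{\alpha,\beta}=\{(\alpha\gamma,\ell(\alpha)-\ell(\beta),\beta\gamma)\mid\gamma\in X\}$. $D_0=\{(x,0,x)\mid x\in X\}$ is the unit space. A cocycle is a continuous function $d:G_n\to\mathbb{R}$ with $d(x,k,y)+d(y,l,z)=d(x,k+l,z)$ for all $(x,k,y),(y,l,z)\in G_n$. *)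

(* Defs.v *)
From HB Require Import structures.
From mathcomp Require Import all_boot all_order all_algebra.
From mathcomp Require Import zify.
From mathcomp Require Import all_classical all_reals all_analysis.

Set Implicit Arguments.
Unset Strict Implicit.
Unset Printing Implicit Defensive.

Import Order.TTheory GRing.Theory Num.Theory.
Import numFieldNormedType.Exports.

Local Open Scope classical_set_scope.
Local Open Scope ring_scope.

(* The letters 1, ..., n are represented by 0, ..., n - 1. *)
Definition path_space (n : nat) : Type :=
  prod_topology (fun _ : nat => discrete_topology 'I_n).

HB.instance Definition _ n := Topological.on (path_space n).

(* The concatenation of a finite string and an infinite one: [nth] returns its
   default value, here a letter of [c], exactly when [size a <= i]. *)
Definition concat (n : nat) (a : seq 'I_n) (c : path_space n) : path_space n :=
  fun i : nat => nth (c (i - size a)%N) a i.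

Definition lag (n : nat) (a b : seq 'I_n) : int := (size a)%:Z - (size b)%:Z.

Record cuntz (n : nat) := Cuntz {
  csrc : path_space n;
  cdeg : int;
  ctgt : path_space n;
  cuntzP : exists (a b : seq 'I_n) (c : path_space n),
    [/\ csrc = concat a c, cdeg = lag a b & ctgt = concat b c] }.

HB.instance Definition _ n := gen_eqMixin (cuntz n).
HB.instance Definition _ n := gen_choiceMixin (cuntz n).

Definition cuntz_basic (n : nat) (ab : seq 'I_n * seq 'I_n) : set (cuntz n) :=
  [set g | exists c : path_space n,
    [/\ csrc g = concat ab.1 c, cdeg g = lag ab.1 ab.2
      & ctgt g = concat ab.2 c]].

Lemma concat_cat (n : nat) (a b : seq 'I_n) (c : path_space n) :
  concat (a ++ b) c = concat a (concat b c).
Proof.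
apply: funext => i; rewrite /concat nth_cat size_cat.
case: ltnP => ia; first exact: set_nth_default.
by rewrite subnDA [RHS]nth_default.
Qed.

Lemma concat_inj (n : nat) (a : seq 'I_n) : injective (concat a).
Proof.
move=> x y xy; apply: funext => i.
have := congr1 (fun f : path_space n => f (size a + i)%N) xy.
by rewrite /concat addKn !nth_default ?leq_addr.
Qed.

Lemma concat_eqsize (n : nat) (a b : seq 'I_n) (x y : path_space n) :
  size a = size b -> concat a x = concat b y -> a = b.
Proof.
move=> sab xy; apply: (@eq_from_nth _ (x 0%N)) => // i ia.
have := congr1 (fun f : path_space n => f i) xy; rewrite /concat.
rewrite (set_nth_default (x 0%N)) // => ->.
by apply: set_nth_default; rewrite -sab.
Qed.

Lemma concat_prefix (n : nat) (a b : seq 'I_n) (x y : path_space n) :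
  (size a <= size b)%N -> concat a x = concat b y ->
  exists2 e, b = a ++ e & x = concat e y.
Proof.
move=> sab; rewrite -{1}(cat_take_drop (size a) b) concat_cat => xy.
have ab : a = take (size a) b.
  by apply: concat_eqsize xy; rewrite size_takel.
exists (drop (size a) b); first by rewrite {1}ab cat_take_drop.
by apply: (@concat_inj _ a); rewrite xy -ab.
Qed.

Lemma cuntz_mul_subproof (n : nat) (g h : cuntz n) : ctgt g = csrc h ->
  exists (a b : seq 'I_n) (c : path_space n),
    [/\ csrc g = concat a c, cdeg g + cdeg h = lag a b & ctgt h = concat b c].
Proof.
case: g h => [x k y [a [b [c [/= xE kE yE]]]]] [y' l z [/= p [q [r [yE' lE zE]]]]].
rewrite xE kE zE lE {}yE {}yE' {x k y y' l z xE kE zE lE} => bp.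
have [sbp|/ltnW spb] := leqP (size b) (size p).
- have [e pE ->] := concat_prefix sbp bp; subst p.
  exists (a ++ e), q, r; rewrite concat_cat; split => //.
  by rewrite /lag !size_cat !PoszD; lia.
- have [e bE ->] := concat_prefix spb (esym bp); subst b.
  exists a, (q ++ e), c; rewrite concat_cat; split => //.
  by rewrite /lag !size_cat !PoszD; lia.
Qed.

(* [g] and [h] are composable when [ctgt g = csrc h]. *)
Definition cuntz_mul (n : nat) (g h : cuntz n) (gh : ctgt g = csrc h) :
  cuntz n := Cuntz (cuntz_mul_subproof gh).

Lemma cuntz_inv_subproof (n : nat) (g : cuntz n) :
  exists (a b : seq 'I_n) (c : path_space n),
    [/\ ctgt g = concat a c, - cdeg g = lag a b & csrc g = concat b c].
Proof.
case: g => [x k y [a [b [c [/= xE kE yE]]]]]; exists b, a, c; split => //.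
by rewrite kE /lag opprB.
Qed.

Definition cuntz_inv (n : nat) (g : cuntz n) : cuntz n :=
  Cuntz (cuntz_inv_subproof g).

Lemma cuntz_unit_subproof (n : nat) (x : path_space n) :
  exists (a b : seq 'I_n) (c : path_space n),
    [/\ x = concat a c, 0 = lag a b & x = concat b c].
Proof.
exists [::], [::], x; rewrite /lag subrr; split => //;
by apply: funext => i; rewrite /concat nth_nil subn0.
Qed.

Definition cuntz_unit (n : nat) (x : path_space n) : cuntz n :=
  Cuntz (cuntz_unit_subproof x).

Definition cuntz_diag (n : nat) : set (cuntz n) := range (@cuntz_unit n).

Lemma cuntz_basic_cover (n : nat) :
  \bigcup_(ab in [set: seq 'I_n * seq 'I_n]) cuntz_basic ab = setT.
Proof.
by rewrite -subTset => g _; have [a [b [c abc]]] := cuntzP g; exists (a, b); [|exists c].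
Qed.

Lemma cuntz_basic_sub (n : nat) (a b p q : seq 'I_n) (g : cuntz n) :
  (size a <= size p)%N -> cuntz_basic (a, b) g -> cuntz_basic (p, q) g ->
  cuntz_basic (p, q) `<=` cuntz_basic (a, b).
Proof.
move=> sap [c /= [sE dE tE]] [c' /= [sE' dE' tE']].
have dd : lag a b = lag p q by rewrite -dE.
have sbq : (size b <= size q)%N by move: dd sap; rewrite /lag; lia.
have [e pE cE] := concat_prefix sap (etrans (esym sE) sE').
have [f qE cE'] := concat_prefix sbq (etrans (esym tE) tE').
have ef : e = f.
  apply: (@concat_eqsize _ _ _ c' c'); last by rewrite -cE.
  by move: dd; rewrite pE qE /lag !size_cat; lia.
move=> h [w /= [hs hd ht]]; exists (concat e w) => /=.
by rewrite hs hd ht dd pE qE -ef !concat_cat.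
Qed.

Lemma cuntz_basic_join (n : nat) (i j : seq 'I_n * seq 'I_n) (g : cuntz n) :
  setT i -> setT j -> cuntz_basic i g -> cuntz_basic j g ->
  exists k, [/\ setT k, cuntz_basic k g
    & cuntz_basic k `<=` cuntz_basic i `&` cuntz_basic j].
Proof.
case: i j => [a b] [p q] _ _ gi gj.
have [sap|/ltnW spa] := leqP (size a) (size p).
- exists (p, q); split => // h hj; split => //.
  exact: (cuntz_basic_sub sap gi gj).
- exists (a, b); split => // h hi; split => //.
  exact: (cuntz_basic_sub spa gj gi).
Qed.

(* [isBaseTopological] requires a pointed type of indices. *)
HB.instance Definition _ (T : choiceType) := isPointed.Build (seq T) [::].

HB.instance Definition _ (n : nat) :=
  @isBaseTopological.Build (cuntz n) (seq 'I_n * seq 'I_n)%type setT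
    (@cuntz_basic n) (@cuntz_basic_cover n) (@cuntz_basic_join n).

Definition cocycle (R : realType) (n : nat) (d : cuntz n -> R) : Prop :=
  continuous d /\
  forall (g h : cuntz n) (gh : ctgt g = csrc h),
    d g + d h = d (cuntz_mul gh).

(* Main.v *)
Require Import Defs.
From HB Require Import structures.
From mathcomp Require Import all_boot all_order all_algebra.
From mathcomp Require Import zify.
From mathcomp Require Import all_classical all_reals all_analysis.

Import Order.TTheory GRing.Theory Num.Theory.
Import numFieldNormedType.Exports.

Local Open Scope classical_set_scope.
Local Open Scope ring_scope.

(** Write [arrow a b c] for the element (ac, l(a) - l(b), bc) of the groupoid.
Both obstructions come from the additivity of a cocycle d along the
compositions (ac, bc) (bc, ec) = (ac, ec).

Bounded case.  Let w = iii... be a constant sequence.  The element (w, 1, w)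
has infinite order in the isotropy group of w, and d is a homomorphism on that
group.  A bounded homomorphism into the reals is zero, so d vanishes at
(w, 1, w), which is not a unit ([bounded_cocycle_loop]).

Integer case.  Fix w and compare the words a of length L through the integers
d(aw, L, w).  Removing the letters of a one at a time writes d(aw, L, w) as a
sum of L values of the functions x |-> d(ix, 1, x), one for each letter i.
These are continuous on a compact space, hence bounded, so
|d(aw, L, w)| <= M L with M independent of L ([cocycle_word_bound]).  There are
n ^ L words and only 2 M L + 1 possible values; as n >= 2, for large L two words
a <> b share the same value, and then d(aw, 0, bw) = 0 although aw <> bw. *)

Lemma cuntz_eq (n : nat) (g h : cuntz n) :
  csrc g = csrc h -> cdeg g = cdeg h -> ctgt g = ctgt h -> g = h.
Proof.
case: g h => [x k y P] [x' k' y' P'] /= xx kk yy.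
by subst; congr Cuntz; exact: Prop_irrelevance.
Qed.

Lemma arrow_subproof (n : nat) (a b : seq 'I_n) (c : path_space n) :
  exists (a' b' : seq 'I_n) (c' : path_space n),
    [/\ concat a c = concat a' c', lag a b = lag a' b'
      & concat b c = concat b' c'].
Proof. by exists a, b, c. Qed.

Definition arrow (n : nat) (a b : seq 'I_n) (c : path_space n) : cuntz n :=
  Cuntz (arrow_subproof n a b c).

Arguments arrow {n} a b c.

(** Letters at the head of the common tail may be moved into both words, which
leaves the lag unchanged.  This allows an element to be factored one letter at a
time, and any two basic sets around it to be compared. *)
Lemma arrow_cat (n : nat) (a b e : seq 'I_n) (c : path_space n) :
  arrow (a ++ e) (b ++ e) c = arrow a b (concat e c).
Proof.
by apply: cuntz_eq; rewrite /= ?concat_cat //; rewrite /lag !size_cat; lia.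
Qed.

Lemma arrow_basic (n : nat) (a b : seq 'I_n) (c : path_space n) :
  cuntz_basic (a, b) (arrow a b c).
Proof. by exists c. Qed.

Lemma cuntz_diagP (n : nat) (g : cuntz n) :
  cuntz_diag g <-> cdeg g = 0 /\ csrc g = ctgt g.
Proof.
split=> [[x _ <-] //|[k0 st]].
by exists (csrc g) => //; exact: cuntz_eq.
Qed.

Lemma cocycle_arrow (R : realType) (n : nat) (d : cuntz n -> R)
    (a b e : seq 'I_n) (c : path_space n) : cocycle d ->
  d (arrow a b c) + d (arrow b e c) = d (arrow a e c).
Proof.
case=> _ dM; rewrite (dM _ _ (erefl : ctgt (arrow a b c) = csrc (arrow b e c))).
by congr d; apply: cuntz_eq; rewrite //= /lag; lia.
Qed.

Lemma const_concat (n : nat) (i : 'I_n) :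
  concat [:: i] (fun=> i) = (fun=> i) :> path_space n.
Proof. by apply: funext => -[|j] //; rewrite /concat nth_default. Qed.

(** [arrow (nseq m.+1 i) [::] w] is the power m + 1 of the loop at the constant
sequence w = iii..., because w is unchanged when letters i are prefixed. *)
Lemma cocycle_loop (R : realType) (n : nat) (d : cuntz n -> R) (i : 'I_n)
    (m : nat) : cocycle d ->
  d (arrow (nseq m.+1 i) [::] (fun=> i)) =
  d (arrow [:: i] [::] (fun=> i)) *+ m.+1.
Proof.
move=> dc; elim: m => [//|m IHm].
rewrite -(cocycle_arrow _ _ _ _ [:: i]) // mulrSr -IHm; congr (_ + _).
have -> : nseq m.+2 i = nseq m.+1 i ++ [:: i] by rewrite -(nseqD m.+1 1) addn1.
by rewrite (arrow_cat n _ [::] [:: i]) const_concat.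
Qed.

(** The powers of a loop carry the multiples of one real number, which are
bounded only if that number is zero. *)
Lemma bounded_cocycle_loop (R : realType) (n : nat) (d : cuntz n -> R)
    (i : 'I_n) : cocycle d -> bounded_fun d ->
  d (arrow [:: i] [::] (fun=> i)) = 0.
Proof.
move=> dc [M [_ /(_ (M + 1)) dM]]; apply/eqP; rewrite -normr_le0 leNgt.
apply/negP; set t := `|_| => t0.
have [m Mm] : exists m : nat, M + 1 < t *+ m.+1.
  exists (Num.truncn ((M + 1) / t)); rewrite -mulr_natl -ltr_pdivrMr //.
  exact: truncnS_gt.
have := dM _ (arrow (nseq m.+1 i) [::] (fun=> i)) I.
rewrite ltrDl ltr01 /= => /(_ isT).
by rewrite cocycle_loop // normrMn leNgt Mm.
Qed.

(** Tychonoff's theorem for finite discrete factors. *)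
Lemma compact_path_space (n : nat) : compact [set: path_space n].
Proof.
have := @tychonoff nat (fun=> discrete_topology 'I_n) (fun=> setT)
  (fun=> @finite_compact (discrete_topology 'I_n) setT
    (@finite_finset 'I_n setT)).
by congr (compact _); rewrite eqEsubset.
Qed.

Lemma nbhs_cylinder (n : nat) (e : seq 'I_n) (c : path_space n) :
  nbhs (concat e c) (range (concat e)).
Proof.
pose x := concat e c.
have : nbhs x [set y : path_space n | forall i : 'I_(size e), y i = x i].
  apply: (@filter_forall (path_space n) 'I_(size e) (fun i y => y i = x i)
    (nbhs x)) => i.
  exact: (@proj_continuous nat (fun=> discrete_topology 'I_n) i x [set x i]
    (discrete_set1 _)).
apply: filterS => y yx /=; exists (fun i => y (size e + i)%N) => //.
apply: funext => i; rewrite /concat; case: (ltnP i (size e)) => ie.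
  by rewrite (yx (Ordinal ie)) /x /concat; exact: set_nth_default.
by rewrite nth_default // subnKC.
Qed.

(** This transfers the compactness of the path space to the basic open sets of
the groupoid, which is itself not compact. *)
Lemma continuous_arrow (n : nat) (a b : seq 'I_n) : continuous (arrow a b).
Proof.
move=> x A /= [_ [[D _ <-] [[p q] Dpq gpq] DA]].
(* Cutting x after [size p] letters makes the pair (a ++ e, b ++ e) at least as
   long as (p, q), so that its basic set lies inside the one of (p, q). *)
pose e := mkseq x (size p); pose c : path_space n := fun i => x (size p + i)%N.
have xE : x = concat e c.
  apply: funext => i; rewrite /concat size_mkseq; case: (ltnP i (size p)) => ip.
    by rewrite nth_mkseq.
  by rewrite nth_default ?size_mkseq // /c subnKC.
rewrite xE; apply: filterS (nbhs_cylinder n e c) => _ [c' _ <-] /=.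
apply: DA; exists (p, q) => //.
have sub g := @cuntz_basic_sub n p q (a ++ e) (b ++ e) g.
apply: (sub (arrow a b x)) => //.
- by rewrite size_cat size_mkseq leq_addl.
- by rewrite xE -arrow_cat; exact: arrow_basic.
- by rewrite -arrow_cat; exact: arrow_basic.
Qed.

Lemma cocycle_letter_bound (R : realType) (n : nat) (d : cuntz n -> R)
    (i : 'I_n) : cocycle d ->
  exists m : nat, forall x, `|d (arrow [:: i] [::] x)| <= m%:R.
Proof.
case=> dcont _; pose f x := d (arrow [:: i] [::] x).
have fcont : continuous f.
  by move=> x; apply: continuous_comp; [exact: continuous_arrow|exact: dcont].
have [M [_ fM]] : bounded_set (f @` setT).
  apply: compact_bounded; apply: continuous_compact (compact_path_space n).
  exact: continuous_subspaceT.
exists (Num.truncn M).+1 => x; apply: fM; first exact: truncnS_gt.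
by exists x.
Qed.

(** Only the length of the word enters the bound, and it enters linearly: the
element factors into one-letter shifts, each bounded uniformly on the path
space. *)
Lemma cocycle_word_bound (R : realType) (n : nat) (d : cuntz n -> R) :
  cocycle d ->
  exists M : nat, forall a c, `|d (arrow a [::] c)| <= (M * size a)%:R.
Proof.
move=> dc; have /choice[m dm] i := cocycle_letter_bound R n d i dc.
exists (\sum_i m i)%N => a c; elim: a => [|i a IHa].
  have := cocycle_arrow _ _ _ [::] [::] [::] c dc.
  by move=> /eqP; rewrite -subr_eq0 addrK => /eqP ->; rewrite normr0.
rewrite -(cocycle_arrow _ _ _ _ a) // mulnS natrD.
apply: (le_trans (ler_normD _ _)); apply: lerD IHa.
rewrite (arrow_cat n [:: i] [::] a); apply: (le_trans (dm i _)).
by rewrite ler_nat (bigD1 i) //= leq_addr.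
Qed.

Lemma int_pigeonhole (R : realType) (T : finType) (f : T -> R) (B : nat) :
  (forall x, f x \is a Num.int) -> (forall x, `|f x| <= B%:R) ->
  (B.*2.+1 < #|T|)%N -> exists x y, x != y /\ f x = f y.
Proof.
move=> fint fB BT.
(* The integers of [-B, B], translated by B to become 0, ..., 2 B. *)
pose h x : 'I_B.*2.+1 := inord (absz (Num.floor (f x) + B%:Z)).
have fK x : f x = (Num.floor (f x))%:~R by rewrite floorK.
have hB x : (- B%:Z <= Num.floor (f x) <= B%:Z)%R.
  by rewrite -!(ler_int R) -fK rmorphN /= -ler_norml; exact: fB.
have : ~~ injectiveb h.
  apply/negP => /injectiveP /leq_card; rewrite card_ord.
  by rewrite leqNgt BT.
move=> /injectivePn[x [y xy hxy]]; exists x, y; split=> //.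
rewrite [LHS]fK [RHS]fK; congr _%:~R.
have := congr1 val hxy; move: (hB x) (hB y) => hBx hBy.
by rewrite /= !inordK; lia.
Qed.

Lemma linear_lt_exp (M n : nat) : (2 <= n)%N ->
  exists L, ((M * L).*2.+1 < n ^ L)%N.
Proof.
(* With L = 2 k, squaring k + 1 <= 2 ^ k suffices, since (k + 1) ^ 2 exceeds
   4 M k + 1 as soon as k > 4 M. *)
move=> n2; pose k := (4 * M).+1; exists (2 * k)%N.
apply: (@leq_trans (2 ^ (2 * k))); last by rewrite leq_exp2r // /k; lia.
have -> : (2 ^ (2 * k) = 2 ^ k * 2 ^ k)%N by rewrite mul2n -addnn expnD.
have k2 : (k < 2 ^ k)%N by exact: ltn_expl.
have : (k.+1 * k.+1 <= 2 ^ k * 2 ^ k)%N by exact: leq_mul.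
rewrite /k; nia.
Qed.

Theorem theorem4 (R : realType) (n : nat) (hn : (2 <= n)%N) :
  (~ exists d : cuntz n -> R,
      [/\ cocycle d, bounded_fun d & d @^-1` [set 0] = @cuntz_diag n]) /\
  (~ exists d : cuntz n -> R,
      [/\ cocycle d, (forall g, d g \is a Num.int)
        & d @^-1` [set 0] = @cuntz_diag n]).
Proof.
pose i0 : 'I_n := Ordinal (ltnW hn); pose w : path_space n := fun=> i0.
split=> -[d [dc dP d0]].
  (* The loop has degree 1, so it is not a unit. *)
  have : cuntz_diag (arrow [:: i0] [::] w).
    by rewrite -d0; exact: bounded_cocycle_loop.
  by case/cuntz_diagP.
have [M dM] := cocycle_word_bound R n d dc.
have [L ML] := linear_lt_exp M n hn.
have [||a [b [/eqP ab dab]]] := @int_pigeonhole R (L.-tuple 'I_n)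
    (fun a => d (arrow a [::] w)) (M * L) (fun=> dP _).
- by move=> a; rewrite -{2}(size_tuple a).
- by rewrite card_tuple card_ord.
(* arrow a b w composed with arrow b [::] w is arrow a [::] w, and d takes the
   same value on the last two. *)
have : cuntz_diag (arrow a b w).
  rewrite -d0 /=; have := cocycle_arrow _ _ _ a b [::] w dc.
  by rewrite dab -[RHS]add0r => /addIr.
case/cuntz_diagP => _ /concat_eqsize; rewrite !size_tuple => /(_ erefl) eab.
exact/ab/val_inj.
Qed.
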